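(* Let $\mathcal{X}$ be a finite set, $U:\mathcal{X}\to\mathbb{R}$ with $\min_xU(x)=0$, $Q$ the generator of an ergodic continuous-time Markov chain on $\mathcal{X}$ reversible with respect to its stationary distribution $\pi$, and $T(t)$ a cooling schedule. There is a constant $A>0$ such that for all $t\geq 0$, $$\lambda_2(-M_{2,t})\geq A\exp\Big\{-\frac{c_{M_2}}{T(t)}\Big\}.$$
   Context: $\mathcal{X}$ has at least two points. A cooling schedule is a function $T(t)>0$ that is monotonically decreasing to $0$ as $t\to\infty$. Reversibility: $\pi(x)Q(x,y)=\pi(y)Q(y,x)$ for all $x,y$. For $x\neq y$, $M_{2,t}(x,y)=Q(x,y)\max\{1,e^{(U(x)-U(y))/T(t)}\}=Q(x,y)e^{(U(x)-U(y))_+/T(t)}$ (with $a_+=\max\{a,0\}$), and $M_{2,t}(x,x)=-\sum_{z\neq x}M_{2,t}(x,z)$. This generator is reversible with respect to the Gibbs distribution $\pi_{T(t)}(x)=e^{-U(x)/T(t)}\pi(x)/Z_{T(t)}$, $Z_{T(t)}=\sum_xe^{-U(x)/T(t)}\pi(x)$, and $\lambda_2(-M_{2,t})$ is its spectral gap (second smallest eigenvalue of $-M_{2,t}$), equivalently $\inf\{\langle -M_{2,t}f,f\rangle_{\pi_{T(t)}}/\langle f,f\rangle_{\pi_{T(t)}}: f\neq0,\ \pi_{T(t)}(f)=0\}$, where $\langle f,g\rangle_\mu=\sum_xf(x)g(x)\mu(x)$ and $\mu(f)=\sum_xf(x)\mu(x)$. A path from $x$ to $y$ is a sequence $\gamma=(\gamma_i)_{i=0}^n$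 with $\gamma_0=x$, $\gamma_n=y$ and $Q(\gamma_{i-1},\gamma_i)>0$ for $i=1,\ldots,n$; $\Gamma^{x,y}$ is the set of such paths. $\mathrm{Elev}_2(\gamma)=\max_{1\le i\le n}\min\{U(\gamma_{i-1}),U(\gamma_i)\}$, $H_2(x,y)=\min_{\gamma\in\Gamma^{x,y}}\mathrm{Elev}_2(\gamma)$, and $c_{M_2}=\max_{x\neq y}\{H_2(x,y)-U(x)-U(y)\}$. *)

(* Defs.v *)
From HB Require Import structures.
From mathcomp Require Import all_boot all_order all_algebra.
From mathcomp Require Import all_classical all_reals all_analysis.

Set Implicit Arguments.
Unset Strict Implicit.
Unset Printing Implicit Defensive.

Import Order.TTheory GRing.Theory Num.Theory.
Import numFieldNormedType.Exports.

Local Open Scope classical_set_scope.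
Local Open Scope ring_scope.

Section Chain.
Context {R : realType} {X : finType}.
Implicit Types (Q : X -> X -> R) (mu U : X -> R).

Definition is_generator Q : Prop :=
  (forall x y, x != y -> 0 <= Q x y) /\
  (forall x, Q x x = - \sum_(z | z != x) Q x z).

Definition edge Q : rel X := fun x y => 0 < Q x y.

(* For a continuous-time chain on a finite set, ergodicity is irreducibility:
   there is no periodicity, and positive recurrence is automatic. *)
Definition ergodic Q : Prop := forall x y, connect (edge Q) x y.

Definition is_distribution mu : Prop :=
  (forall x, 0 <= mu x) /\ \sum_x mu x = 1.

Definition stationary Q mu : Prop := forall y, \sum_x mu x * Q x y = 0.

Definition reversible Q mu : Prop :=
  forall x y, mu x * Q x y = mu y * Q y x.

(* The path (g_0, ..., g_n) from x is represented by its tail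
   p = [:: g_1; ...; g_n], with g_0 = x. *)
Definition paths Q (x y : X) : set (seq X) :=
  [set p | path (edge Q) x p /\ last x p = y].

(* sup and inf below are those of finite sets of reals, which are nonempty for
   x != y and Q ergodic; they are then the max and the min. *)
Definition Elev2 U (x : X) (p : seq X) : R :=
  sup [set` pairmap (fun a b => Num.min (U a) (U b)) x p].

Definition H2 Q U (x y : X) : R := inf [set Elev2 U x p | p in paths Q x y].

Definition cM2 Q U : R :=
  sup [set H2 Q U z.1 z.2 - U z.1 - U z.2 | z in [set z : X * X | z.1 != z.2]].

(* tau is the temperature T(t). *)
Definition M2_rate Q U (tau : R) (x y : X) : R :=
  Q x y * Num.max 1 (expR ((U x - U y) / tau)).

Definition M2 Q U (tau : R) (x y : X) : R :=
  if x == y then - \sum_(z | z != x) M2_rate Q U tau x z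
  else M2_rate Q U tau x y.

Definition kernel_mx (K : X -> X -> R) : 'M[R]_#|X| :=
  \matrix_(i, j) K (enum_val i) (enum_val j).

End Chain.

(* The eigenvalues of A in nondecreasing order, repeated according to their
   multiplicity, when the characteristic polynomial splits over R (e.g. when A
   is symmetric with respect to some positive weight); [::] otherwise. *)
Definition sorted_eigenvalues {R : realType} {n : nat} (A : 'M[R]_n) : seq R :=
  xget [::] [set s : seq R | sorted <=%R s /\
                             char_poly A = \prod_(a <- s) ('X - a%:P)].

(* The second smallest eigenvalue (index 1, counting from 0). *)
Definition lambda2 {R : realType} {n : nat} (A : 'M[R]_n) : R :=
  (sorted_eigenvalues A)`_1.

Definition cooling_schedule {R : realType} (T : R -> R) : Prop :=
  [/\ forall t, 0 <= t -> 0 < T t,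
      forall s t, 0 <= s -> s <= t -> T t <= T s
    & T t @[t --> +oo] --> (0 : R)].

(* Main.v *)
Require Import Defs.
From HB Require Import structures.
From mathcomp Require Import all_boot all_order all_algebra.
From mathcomp Require Import all_classical all_reals all_analysis.
From mathcomp Require Import complex.
From mathcomp Require Import ring.

Set Implicit Arguments.
Unset Strict Implicit.
Unset Printing Implicit Defensive.

Import Order.TTheory GRing.Theory Num.Theory.
Import numFieldNormedType.Exports.

Local Open Scope classical_set_scope.
Local Open Scope ring_scope.

(** The weights e^(-U/tau) pi make the generator M2 reversible, so its spectral
    gap is the best constant in a Poincare inequality, and such an inequality
    follows from comparing f x - f y with the increments of f along a path.

    The spectral half turns a Poincare inequality into a bound on the second
    sorted root of the characteristic polynomial.  A matrix reversible for
    positive weights is conjugate to a symmetric one, hence diagonalizable over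
    the reals ([reversible_diagonalizable]); the sorted list of eigenvalues is
    then the sorted diagonal ([sorted_eigenvalues_diag]).  The eigenvectors of
    the two smallest eigenvalues span a plane, which contains a nonzero vector
    of mean zero, and the Rayleigh quotient of that vector is at most the second
    eigenvalue ([lambda2_ge]).

    The probabilistic half is the Poincare inequality at temperature tau.  For
    x != y, the conductance of an edge (a, b) is
    pi(a) Q(a,b) e^(-min(U a, U b)/tau), so along a path of least elevation from
    x to y it is at least q e^(-H2(x,y)/tau) with q independent of tau.  The
    weights of x and y contribute e^(-(U x + U y)/tau), whence a bound on
    mu(x) mu(y) (f x - f y)^2 by C(x,y) e^(cM2/tau) times the Dirichlet energy
    ([pair_bound]), in which the path, and therefore C(x,y), does not depend on
    tau.  Summing over all pairs gives the variance of f times the total mass,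
    and the total mass is at least pi(x0) for a minimizer x0 of U: this is what
    makes the final constant uniform in the temperature. *)

(** * Diagonalization of reversible matrices *)

(** The spectral theorem for Hermitian matrices applies over the complex
    numbers; the spectrum is real, and two real matrices that are similar over
    the complex numbers are similar over the reals.  Orthogonality of the base
    change is lost in the descent; [lambda2_ge] recovers what it needs of it
    from symmetry. *)
Lemma symmetric_diagonalizable (R : realType) n (S : 'M[R]_n) :
  S^T = S ->
  exists P : 'M[R]_n, exists2 d : 'rV[R]_n,
    P \in unitmx & P *m S = diag_mx d *m P.
Proof.
move=> symS; pose toC := complex.real_complex R.
have toC_real a b (B : 'M[R]_(a, b)) : map_mx toC B \is a mxOver Num.real.
  by apply/mxOverP => i j; rewrite mxE complex.complex_real.
have descend a b (B : 'M[complex.complex R]_(a, b)) :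
    B \is a mxOver Num.real -> exists B' : 'M[R]_(a, b), B = map_mx toC B'.
  move=> /mxOverP realB; exists (map_mx (@complex.Re R) B).
  apply/matrixP => i j; rewrite !mxE.
  by have /complex.complex_realP[k ->] := realB i j.
set SC := map_mx toC S.
have hermS : SC \is hermsymmx.
  apply: realsym_hermsym; last exact: toC_real.
  apply/is_hermitianmxP.
  by rewrite expr0 scale1r map_mx_id // /SC; rewrite -[in LHS]symS map_trmx.
have [d eq_d] := descend _ _ _ (hermitian_spectral_diag_real hermS).
have /hermitian_normalmx /orthomx_spectralP eqS := hermS.
have simS : similar_in unitmx SC (diag_mx (spectral_diag SC)).
  exists (spectralmx SC); first exact: spectral_unit.
  apply/similarP; first exact: spectral_unit.
  by rewrite {2}eqS !mulmxA mulmxV ?spectral_unit // mul1mx.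
have realD : diag_mx (spectral_diag SC) \is a mxOver Num.real.
  by rewrite eq_d -map_diag_mx toC_real.
have [P /andP[/= realP unitP]] := real_similar simS (toC_real _ _ S) realD.
move=> /(similarP unitP).
have [P' eqP'] := descend _ _ _ realP.
move: unitP; rewrite eqP' map_unitmx eq_d -map_diag_mx -!map_mxM => unitP'.
by move=> /map_mx_inj eqPS; exists P', d.
Qed.

Lemma char_poly_similar (F : fieldType) n (P A B : 'M[F]_n) :
  P \in unitmx -> P *m A = B *m P -> char_poly A = char_poly B.
Proof.
move=> unitP eqPA; pose PX := map_mx polyC P.
have: PX *m char_poly_mx A = char_poly_mx B *m PX.
  rewrite /char_poly_mx mulmxBr mulmxBl -!map_mxM eqPA.
  by rewrite scalar_mxC.
move=> /(congr1 determinant); rewrite !det_mulmx mulrC; apply: mulIf.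
by rewrite det_map_mx polyC_eq0 -unitfE -unitmxE.
Qed.

Lemma char_poly_diag (F : fieldType) n (d : 'rV[F]_n) :
  char_poly (diag_mx d) = \prod_(a <- [seq d 0 i | i <- enum 'I_n]) ('X - a%:P).
Proof.
rewrite char_poly_trig; last exact: diag_mx_is_trig.
rewrite big_map big_enum /=; apply: eq_bigr => i _.
by rewrite mxE eqxx mulr1n.
Qed.

(** Detailed balance says exactly that D A D^-1 is symmetric, where D is the
    diagonal matrix of the square roots of the weights. *)
Lemma reversible_diagonalizable (R : realType) n (A : 'M[R]_n)
  (mu : 'I_n -> R) :
  (forall i, 0 < mu i) -> (forall i j, mu i * A i j = mu j * A j i) ->
  exists P : 'M[R]_n, exists2 d : 'rV[R]_n,
    P \in unitmx & A *m P = P *m diag_mx d.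
Proof.
move=> mu_gt0 rev.
pose r : 'rV[R]_n := \row_i Num.sqrt (mu i).
pose r' : 'rV[R]_n := \row_i (Num.sqrt (mu i))^-1.
have s_neq0 i : Num.sqrt (mu i) != 0 by rewrite gt_eqF // sqrtr_gt0.
have rK : diag_mx r *m diag_mx r' = 1%:M.
  rewrite mulmx_diag; apply/matrixP => i j; rewrite !mxE.
  by rewrite divff.
have rK' : diag_mx r' *m diag_mx r = 1%:M by apply: mulmx1C.
pose S := diag_mx r *m A *m diag_mx r'.
have symS : S^T = S.
  apply/matrixP => i j; rewrite /S mxE !mul_mx_diag !mul_diag_mx !mxE.
  apply: (mulfI (s_neq0 i)); apply: (mulfI (s_neq0 j)).
  have sq k : mu k = Num.sqrt (mu k) * Num.sqrt (mu k).
    by rewrite -expr2 sqr_sqrtr // ltW.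
  have := rev j i; rewrite {1}(sq j) {1}(sq i).
  move=> rij; transitivity (Num.sqrt (mu j) * Num.sqrt (mu j) * A j i).
    by field; rewrite s_neq0.
  by rewrite rij; field; rewrite s_neq0.
have [P [d unitP eqP]] := symmetric_diagonalizable symS.
exists (diag_mx r' *m P^T), d.
  rewrite unitmx_mul unitmx_tr unitP andbT.
  by have [] := mulmx1_unit rK.
have: S *m P^T = P^T *m diag_mx d.
  by rewrite -{1}symS -trmx_mul eqP trmx_mul tr_diag_mx.
move=> /(congr1 (mulmx (diag_mx r'))); rewrite /S !mulmxA rK' mul1mx.
by rewrite -!mulmxA.
Qed.

(** * The second eigenvalue and the Poincare inequality *)

(** The characteristic polynomial determines its roots up to permutation, hence
    determines the sorted list. *)
Lemma sorted_eigenvalues_diag (R : realType) n (A P : 'M[R]_n) (d : 'rV[R]_n) :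
  P \in unitmx -> A *m P = P *m diag_mx d ->
  sorted_eigenvalues A = sort <=%R [seq d 0 i | i <- enum 'I_n].
Proof.
move=> unitP eqAP; set s := [seq _ | _ <- _].
have charA : char_poly A = \prod_(a <- s) ('X - a%:P).
  rewrite -char_poly_diag; apply: (@char_poly_similar _ _ (invmx P)).
    by rewrite unitmx_inv.
  by rewrite -[A](mulmxK unitP) eqAP !mulmxA mulVmx // mul1mx.
rewrite /sorted_eigenvalues; set E := [set _ | _].
have Es : E (sort <=%R s).
  split; first exact/sort_sorted/le_total.
  by rewrite charA; apply: perm_big; rewrite perm_sym perm_sort.
have [sorted_r char_r] : E (xget [::] E).
  by apply: xgetPex; exists (sort <=%R s).
apply: (sorted_eq le_trans le_anti sorted_r); first by case: Es.
by apply: prod_XsubC_eq; rewrite -char_r; case: Es.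
Qed.

(** Distinct positions i and j are needed, and not only the values, since a
    double smallest eigenvalue must still provide two independent
    eigenvectors. *)
Lemma sorted_first_two (R : realType) n (d : 'I_n -> R) : (1 < n)%N ->
  let s := sort <=%R [seq d i | i <- enum 'I_n] in
  exists i j, [/\ i != j, d i <= d j & s`_1 = d j].
Proof.
move=> n_gt1 s.
have size_s : size s = n by rewrite size_sort size_map size_enum_ord.
have /(perm_iotaP 0) [Is permI eqs] : perm_eq s [seq d i | i <- enum 'I_n].
  by rewrite perm_sort.
rewrite size_map size_enum_ord in permI.
have size_I : size Is = n by rewrite (perm_size permI) size_iota.
have ltI k : (k < n)%N -> (nth 0 Is k < n)%N.
  move=> k_lt; have := mem_nth 0%N (s := Is) (n := k).
  by rewrite size_I k_lt (perm_mem permI) mem_iota => /(_ isT).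
have n_gt0 : (0 < n)%N by apply: ltn_trans n_gt1.
have nth_s k (k_lt : (k < n)%N) : s`_k = d (Ordinal (ltI k k_lt)).
  rewrite eqs (nth_map 0%N) ?size_I //.
  rewrite (nth_map (Ordinal n_gt0)) ?size_enum_ord ?ltI //.
  by congr d; apply: val_inj; rewrite /= nth_enum_ord ?ltI.
exists (Ordinal (ltI 0 n_gt0)), (Ordinal (ltI 1 n_gt1)); split.
- by rewrite -val_eqE /= nth_uniq ?size_I // (perm_uniq permI) iota_uniq.
- rewrite -!nth_s; apply: sorted_leq_nth => //; try exact: le_trans.
  + exact: sort_sorted le_total _.
  + by rewrite inE size_s.
  + by rewrite inE size_s.
- by rewrite -nth_s.
Qed.

(** The easy half of the min-max principle: among the combinations of two
    eigenvectors for d_i <= d_j, one that is nonzero has mean zero, and its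
    Rayleigh quotient is at most d_j. *)
Lemma lambda2_ge (R : realType) n (A : 'M[R]_n) (mu : 'I_n -> R) (b : R) :
  (1 < n)%N -> (forall i, 0 < mu i) ->
  (forall i j, mu i * A i j = mu j * A j i) ->
  (forall f : 'I_n -> R, \sum_i mu i * f i = 0 ->
     b * \sum_i mu i * f i ^+ 2 <=
     \sum_i mu i * f i * \sum_j A i j * f j) ->
  b <= lambda2 A.
Proof.
move=> n_gt1 mu_gt0 rev gap.
have [P [d unitP eqAP]] := reversible_diagonalizable mu_gt0 rev.
rewrite /lambda2 (sorted_eigenvalues_diag unitP eqAP).
have [i [j [neq_ij le_d ->]]] := sorted_first_two (d 0) n_gt1.
have eig k l : \sum_m A k m * P m l = d 0 l * P k l.
  have := congr1 (fun B : 'M[R]_n => B k l) eqAP.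
  by rewrite mul_mx_diag !mxE mulrC.
pose ip (f g : 'I_n -> R) := \sum_k mu k * f k * g k.
(* Either the eigenvalues coincide or the eigenvectors are orthogonal. *)
have ortho : (d 0 i - d 0 j) * ip (P^~ i) (P^~ j) = 0.
  have : \sum_k mu k * P k j * (\sum_m A k m * P m i) =
         \sum_k mu k * P k i * (\sum_m A k m * P m j).
    under eq_bigr do rewrite big_distrr /=.
    rewrite exchange_big /=; apply: eq_bigr => k _; rewrite big_distrr /=.
    apply: eq_bigr => m _.
    transitivity (mu m * A m k * P m j * P k i); first by ring.
    by rewrite rev; ring.
  under eq_bigr do rewrite eig.
  under [RHS]eq_bigr do rewrite eig.
  move=> /eqP; rewrite -subr_eq0 -sumrB => /eqP sum0.
  rewrite /ip big_distrr /= -[RHS]sum0.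
  by apply: eq_bigr => k _; ring.
pose mean l := \sum_k mu k * P k l.
have [a [c [ac_neq0 ac_mean]]] :
    exists a c, (a != 0) || (c != 0) /\ a * mean i + c * mean j = 0.
  have [mi0|mi_neq0] := eqVneq (mean i) 0.
    by exists 1, 0; rewrite oner_eq0 mi0; split => //; ring.
  by exists (- mean j), (mean i); rewrite mi_neq0 orbT; split => //; ring.
pose f k := a * P k i + c * P k j.
have f_mean : \sum_k mu k * f k = 0.
  rewrite -[RHS]ac_mean /mean !big_distrr -big_split /=.
  by apply: eq_bigr => k _; rewrite /f; ring.
have ff_gt0 : 0 < \sum_k mu k * f k ^+ 2.
  have ff_ge0 k : 0 <= mu k * f k ^+ 2 by rewrite mulr_ge0 ?sqr_ge0 // ltW.
  rewrite lt0r sumr_ge0 // andbT; apply/eqP.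
  move=> /eqP; rewrite psumr_eq0 // => /allP f0.
  have {}f0 k : f k = 0.
    have := f0 k (mem_index_enum k); rewrite mulf_eq0 gt_eqF // orFb.
    by rewrite sqrf_eq0 => /eqP.
  pose v : 'cV[R]_n := \col_l (a *+ (l == i) + c *+ (l == j)).
  have Pv : P *m v = 0.
    apply/matrixP => k l; rewrite !mxE -[RHS](f0 k) /f.
    rewrite (bigD1 i) //= (bigD1 j) ?[j == i]eq_sym //= big1 => [|m].
      rewrite !mxE !eqxx (negbTE neq_ij) eq_sym (negbTE neq_ij).
      by rewrite !mulr1n !mulr0n; ring.
    by case/andP=> mi mj; rewrite mxE (negbTE mi) (negbTE mj) addr0 mulr0.
  have v0 : v = 0 by rewrite -[v](mulKmx unitP) Pv mulmx0.
  have := congr1 (fun w : 'cV[R]_n => w i 0) v0.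
  have := congr1 (fun w : 'cV[R]_n => w j 0) v0.
  rewrite !mxE !eqxx (negbTE neq_ij) eq_sym (negbTE neq_ij) !mulr1n !mulr0n.
  rewrite add0r addr0 => c0 a0.
  by move: ac_neq0; rewrite a0 c0 eqxx.
have le_quot : \sum_k mu k * f k * (\sum_m A k m * f m) <=
               d 0 j * \sum_k mu k * f k ^+ 2.
  have Af k : \sum_m A k m * f m = a * d 0 i * P k i + c * d 0 j * P k j.
    rewrite -[X in _ = X + _]mulrA -[X in _ = _ + X]mulrA -!eig !big_distrr.
    by rewrite -big_split /=; apply: eq_bigr => m _; rewrite /f; ring.
  rewrite -subr_ge0.
  suff -> : d 0 j * (\sum_k mu k * f k ^+ 2) -
      \sum_k mu k * f k * (\sum_m A k m * f m) =
      a ^+ 2 * (d 0 j - d 0 i) * (\sum_k mu k * P k i ^+ 2) -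
      a * c * ((d 0 i - d 0 j) * ip (P^~ i) (P^~ j)).
    rewrite ortho mulr0 subr0 mulr_ge0 //.
      by rewrite mulr_ge0 ?sqr_ge0 // subr_ge0.
    by apply: sumr_ge0 => k _; rewrite mulr_ge0 ?sqr_ge0 // ltW.
  rewrite /ip !big_distrr -!sumrB /=; apply: eq_bigr => k _.
  by rewrite Af /f; ring.
by rewrite -(ler_pM2r ff_gt0); apply: le_trans le_quot; apply: gap.
Qed.

(** * Finite suprema and paths of least elevation *)

Lemma finite_set_max (R : realType) (E : set R) :
  finite_set E -> E !=set0 -> exists2 m, E m & ubound E m.
Proof.
move=> /finite_seqP[s ->] [x]; rewrite /= => xs.
suff [m ms le_m] : exists2 m, m \in s & {in s, forall y, y <= m} by exists m.
elim: s x xs => // z [_ _ _|z' s IHs x _].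
  by exists z; rewrite ?mem_head // => y; rewrite inE => /eqP ->.
have [m ms le_m] := IHs z' (mem_head _ _).
have [le_mz|lt_zm] := leP m z.
  exists z; rewrite ?mem_head // => y; rewrite inE => /predU1P[->//|/le_m].
  by move=> /le_trans; apply.
exists m; rewrite 1?inE ?ms ?orbT // => y.
by rewrite inE => /predU1P[->|/le_m//]; exact: ltW.
Qed.

Lemma finite_set_min (R : realType) (E : set R) :
  finite_set E -> E !=set0 -> exists2 m, E m & lbound E m.
Proof.
move=> finE [x Ex].
have [||_ [m Em <-] ub_m] := @finite_set_max R (-%R @` E).
- exact: finite_image.
- by exists (- x), x.
by exists m => // y Ey; rewrite -lerN2; apply: ub_m; exists y.
Qed.

Lemma le_fin_sup (R : realType) (E : set R) x :
  finite_set E -> E x -> x <= sup E.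
Proof.
move=> finE Ex; have [|m _ ub_m] := finite_set_max finE; first by exists x.
by apply: ub_le_sup => //; exists m.
Qed.

Lemma fin_sup_in (R : realType) (E : set R) :
  finite_set E -> E !=set0 -> E (sup E).
Proof.
move=> finE E0; have [m Em ub_m] := finite_set_max finE E0.
suff -> : sup E = m by [].
by apply/le_anti; rewrite ge_sup //= le_fin_sup.
Qed.

Lemma all_pairmap (A B : Type) (g : A -> A -> B) (a : pred B) x p :
  all a (pairmap g x p) = path (fun u v => a (g u v)) x p.
Proof. by elim: p x => //= y p IHp x; rewrite IHp. Qed.

Lemma path_Elev2 (R : realType) (X : finType) (U : X -> R) x p :
  path (fun a b => Num.min (U a) (U b) <= Elev2 U x p) x p.
Proof.
rewrite -(all_pairmap _ (fun v => v <= Elev2 U x p)); apply/allP => v v_in.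
by apply: le_fin_sup => //; apply/finite_seqP; eexists.
Qed.

(** Infinitely many paths may lead from x to y, but they have only finitely many
    elevations, so the infimum in [H2] is a minimum.  The value 0 is that of the
    empty path, since sup set0 = 0. *)
Lemma Elev2_values (R : realType) (X : finType) (U : X -> R) x p :
  Elev2 U x p \in 0 :: [seq Num.min (U a) (U b) | a <- enum X, b <- enum X].
Proof.
case: p => [|y p].
  rewrite /Elev2 /= (_ : [set` [::]] = set0) ?sup0 ?mem_head //.
  by apply/seteqP; split.
rewrite inE; apply/orP; right.
have : all (mem [seq Num.min (U a) (U b) | a <- enum X, b <- enum X])
    (pairmap (fun a b => Num.min (U a) (U b)) x (y :: p)).
  rewrite all_pairmap; elim: (y :: p) x => //= z q IHq w; rewrite IHq andbT.
  by apply/allpairsP; exists (w, z); rewrite !mem_enum.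
move=> /allP; apply; set s := pairmap _ _ _.
change ([set` s] (sup [set` s])); apply: fin_sup_in.
  by apply/finite_seqP; exists s.
by exists (Num.min (U x) (U y)); rewrite /s /= mem_head.
Qed.

Lemma H2_attained (R : realType) (X : finType) (Q : X -> X -> R) (U : X -> R)
  x y : ergodic Q -> exists2 p, paths Q x y p & Elev2 U x p <= H2 Q U x y.
Proof.
move=> erg; set E := [set Elev2 U x p | p in paths Q x y].
have E0 : E !=set0.
  have /connectP[p path_p last_p] := erg x y.
  by exists (Elev2 U x p), p.
have [|_ [p path_p <-] lb_p] := finite_set_min _ E0.
  apply: (@sub_finite_set _ _
    [set` 0 :: [seq Num.min (U a) (U b) | a <- enum X, b <- enum X]]).
    by move=> _ [p _ <-]; apply: Elev2_values.
  by apply/finite_seqP; eexists.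
by exists p => //; apply: lb_le_inf.
Qed.

Lemma H2_le_cM2 (R : realType) (X : finType) (Q : X -> X -> R) (U : X -> R)
  x y : x != y -> H2 Q U x y - U x - U y <= cM2 Q U.
Proof.
move=> neq_xy; apply: le_fin_sup; last by exists (x, y).
by apply: finite_image.
Qed.

(** * Energy, variance and comparison along paths *)

Lemma path_lipschitz (R : realDomainType) (T : Type) (f : T -> R) (r : R) x p :
  path (fun a b => `|f a - f b| <= r) x p ->
  `|f x - f (last x p)| <= r *+ size p.
Proof.
elim: p x => [x _|y p IHp x /= /andP[le_r /IHp le_p]] /=.
  by rewrite subrr normr0.
have -> : f x - f (last y p) = (f x - f y) + (f y - f (last y p)) by ring.
by rewrite mulrS; apply: le_trans (ler_normD _ _) _; rewrite lerD.
Qed.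

Lemma positive_values_lower_bound (R : realType) (I : finType) (F : I -> R) :
  exists2 q, 0 < q & forall i, 0 < F i -> q <= F i.
Proof.
exists (\big[Num.min/1]_(i | 0 < F i) F i); first by apply: lt_bigmin.
by move=> i Fi; apply: bigmin_le_cond.
Qed.

(** Expanding the square, the two diagonal terms vanish because the rows of K,
    and by reversibility also its weighted columns, sum to zero. *)
Lemma dirichlet_form (R : realType) (I : finType) (mu : I -> R)
  (K : I -> I -> R) (f : I -> R) :
  (forall x y, mu x * K x y = mu y * K y x) -> (forall x, \sum_y K x y = 0) ->
  \sum_x \sum_y mu x * K x y * (f x - f y) ^+ 2 =
  2 * \sum_x mu x * f x * \sum_y - K x y * f y.
Proof.
move=> rev K0.
have diag0 : \sum_x \sum_y mu x * K x y * f x ^+ 2 = 0.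
  apply: big1 => x _.
  by rewrite -big_distrl -big_distrr /= K0 mulr0 mul0r.
have diag0' : \sum_x \sum_y mu x * K x y * f y ^+ 2 = 0.
  rewrite exchange_big /= -[RHS]diag0.
  by apply: eq_bigr => y _; apply: eq_bigr => x _; rewrite rev.
transitivity (\sum_x \sum_y mu x * K x y * f x ^+ 2 +
    \sum_x \sum_y mu x * K x y * f y ^+ 2 +
    2 * \sum_x mu x * f x * \sum_y - K x y * f y); last first.
  by rewrite diag0 diag0' !add0r.
rewrite big_distrr -!big_split /=; apply: eq_bigr => x _.
rewrite [2 * _]mulrA big_distrr -!big_split /=; apply: eq_bigr => y _.
by ring.
Qed.

Lemma variance_pairs (R : realType) (I : finType) (mu f : I -> R) :
  \sum_x mu x * f x = 0 ->
  \sum_x \sum_y mu x * mu y * (f x - f y) ^+ 2 =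
  2 * (\sum_x mu x) * \sum_x mu x * f x ^+ 2.
Proof.
move=> mean0.
have sumM (g h : I -> R) :
    (\sum_x g x) * (\sum_y h y) = \sum_x \sum_y g x * h y.
  by rewrite big_distrl /=; apply: eq_bigr => x _; rewrite big_distrr.
have cross : \sum_x \sum_y (mu x * f x) * (mu y * f y) = 0.
  by rewrite -sumM mean0 mul0r.
have left_ := sumM mu (fun x => mu x * f x ^+ 2).
have right_ := sumM (fun x => mu x * f x ^+ 2) mu.
transitivity ((\sum_x mu x) * (\sum_x mu x * f x ^+ 2) +
   (\sum_x mu x * f x ^+ 2) * (\sum_x mu x) -
   2 * \sum_x \sum_y (mu x * f x) * (mu y * f y)); last by rewrite cross; ring.
rewrite left_ right_ big_distrr -big_split -sumrB /=; apply: eq_bigr => x _.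
rewrite big_distrr -big_split -sumrB /=; apply: eq_bigr => y _.
by ring.
Qed.

(** * The Poincare inequality for the generator M2 *)

Section M2Gap.
Context {R : realType} {X : finType}.
Variables (U : X -> R) (Q : X -> X -> R) (pi_ : X -> R).

(** The Gibbs distribution before division by its total mass.  Spectral
    quantities do not depend on the normalization. *)
Definition gibbs_weight (tau : R) (x : X) : R := pi_ x * expR (- (U x / tau)).

(** Twice the Dirichlet form of -M2, by [dirichlet_form]. *)
Definition energy (tau : R) (f : X -> R) : R :=
  \sum_x \sum_y gibbs_weight tau x * M2 Q U tau x y * (f x - f y) ^+ 2.

(** The larger of 1 and e^((U x - U y)/tau) turns the weight e^(-U x/tau) into
    the weight of the lower of the two endpoints; this is why elevations along
    edges are minima. *)
Lemma gibbs_M2 tau x y : 0 < tau -> x != y ->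
  gibbs_weight tau x * M2 Q U tau x y =
  pi_ x * Q x y * expR (- (Num.min (U x) (U y) / tau)).
Proof.
move=> tau_gt0 /negbTE neq_xy; rewrite /M2 neq_xy /M2_rate /gibbs_weight.
suff -> : expR (- (Num.min (U x) (U y) / tau)) =
    expR (- (U x / tau)) * Num.max 1 (expR ((U x - U y) / tau)) by ring.
have [le_xy|lt_yx] := leP (U x) (U y).
  rewrite max_l ?mulr1 // -expR0 ler_expR.
  by rewrite pmulr_lle0 ?invr_gt0 // subr_le0.
rewrite max_r; last first.
  by rewrite -[leLHS]expR0 ler_expR divr_ge0 ?subr_ge0 // ltW.
by rewrite -expRD; congr expR; ring.
Qed.

Lemma M2_reversible tau x y : reversible Q pi_ -> 0 < tau ->
  gibbs_weight tau x * M2 Q U tau x y = gibbs_weight tau y * M2 Q U tau y x.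
Proof.
move=> rev tau_gt0; have [->//|neq_xy] := eqVneq x y.
by rewrite !gibbs_M2 // 1?eq_sym // rev minC.
Qed.

Lemma M2_row_sum tau x : \sum_y M2 Q U tau x y = 0.
Proof.
rewrite (bigD1 x) //= {1}/M2 eqxx.
rewrite (eq_bigr (M2_rate Q U tau x)) ?addNr // => y.
by rewrite eq_sym /M2 => /negbTE ->.
Qed.

(** Some state has positive mass, and detailed balance propagates positivity
    along every edge. *)
Lemma reversible_pi_gt0 : is_generator Q -> ergodic Q -> is_distribution pi_ ->
  reversible Q pi_ -> forall x, 0 < pi_ x.
Proof.
move=> [Q_ge0 _] erg [pi_ge0 pi_sum] rev.
have [x0 pi_x0] : exists x0, 0 < pi_ x0.
  apply: contrapT => /forallNP pi_le0; have := pi_sum; rewrite big1 => [|x _].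
    by move/eqP; rewrite eq_sym oner_eq0.
  by apply/le_anti; rewrite pi_ge0 andbT leNgt; apply/negP.
move=> y; have /connectP[p path_p ->] := erg x0 y.
elim: p x0 pi_x0 path_p => //= y' p IHp x pi_x /andP[Q_xy /IHp]; apply.
rewrite lt0r pi_ge0 andbT; apply/eqP => pi_y'.
by have := mulr_gt0 pi_x Q_xy; rewrite rev pi_y' mul0r ltxx.
Qed.

Hypotheses (Q_gen : is_generator Q) (Q_erg : ergodic Q)
  (pi_gt0 : forall x, 0 < pi_ x).

Lemma energy_term_ge0 tau f x y : 0 < tau ->
  0 <= gibbs_weight tau x * M2 Q U tau x y * (f x - f y) ^+ 2.
Proof.
move=> tau_gt0; have [->|neq_xy] := eqVneq x y.
  by rewrite subrr expr0n mulr0.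
have [Q_ge0 _] := Q_gen.
rewrite gibbs_M2 // mulr_ge0 ?sqr_ge0 // mulr_ge0 ?expR_ge0 //.
by rewrite mulr_ge0 ?Q_ge0 // ltW.
Qed.

Lemma energy_term_le tau f x y : 0 < tau ->
  gibbs_weight tau x * M2 Q U tau x y * (f x - f y) ^+ 2 <= energy tau f.
Proof.
move=> tau_gt0; rewrite /energy (bigD1 x) //= (bigD1 y) //= -addrA lerDl.
rewrite addr_ge0 ?sumr_ge0 // => [z _|z _]; first exact: energy_term_ge0.
by apply: sumr_ge0 => w _; apply: energy_term_ge0.
Qed.

Lemma energy_ge0 tau f : 0 < tau -> 0 <= energy tau f.
Proof.
move=> tau_gt0; apply: sumr_ge0 => x _; apply: sumr_ge0 => y _.
exact: energy_term_ge0.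
Qed.

(** Every edge of a path of least elevation has conductance at least
    q e^(-H2/tau), so that the increment of f across it is at most
    (e^(H2/tau) energy / q)^(1/2); a path of n edges then yields the constant
    n^2 / q.  The path and q are chosen before tau and f. *)
Lemma pair_bound x y : (forall x, pi_ x <= 1) ->
  exists2 C : R, 0 <= C & forall (tau : R) (f : X -> R), 0 < tau ->
    gibbs_weight tau x * gibbs_weight tau y * (f x - f y) ^+ 2 <=
    C * (expR (cM2 Q U / tau) * energy tau f).
Proof.
move=> pi_le1.
have [q q_gt0 q_le] :=
  positive_values_lower_bound (fun z : X * X => pi_ z.1 * Q z.1 z.2).
have [p [path_p last_p] elev_p] := H2_attained U x y Q_erg.
exists ((size p)%:R ^+ 2 / q) => [|tau f tau_gt0].
  by rewrite divr_ge0 ?sqr_ge0 // ltW.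
have [<-|neq_xy] := eqVneq x y.
  rewrite subrr expr0n mulr0 mulr_ge0 ?divr_ge0 ?sqr_ge0 ?(ltW q_gt0) //.
  by rewrite mulr_ge0 ?expR_ge0 ?energy_ge0.
set h := H2 Q U x y.
(* [r2] bounds the squared increment of f across an edge of the path. *)
pose r2 := expR (h / tau) / q * energy tau f.
have r2_ge0 : 0 <= r2.
  by rewrite mulr_ge0 ?energy_ge0 // divr_ge0 ?expR_ge0 // ltW.
have edge_le a b : edge Q a b -> Num.min (U a) (U b) <= h ->
    `|f a - f b| <= Num.sqrt r2.
  move=> Qab le_h; rewrite -(ler_pXn2r (n := 2)) ?nnegrE ?sqrtr_ge0 //.
  rewrite sqr_sqrtr // real_normK ?num_real //.
  have [->|neq_ab] := eqVneq a b; first by rewrite subrr expr0n.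
  have := energy_term_le f a b tau_gt0; rewrite gibbs_M2 // => le_en.
  have -> : (f a - f b) ^+ 2 =
      expR (h / tau) / q * (q * expR (- (h / tau)) * (f a - f b) ^+ 2).
    by rewrite expRN; field; rewrite !gt_eqF ?expR_gt0.
  apply: ler_wpM2l; first by rewrite divr_ge0 ?expR_ge0 // ltW.
  apply: le_trans le_en; rewrite ler_wpM2r ?sqr_ge0 //.
  apply: ler_pM; rewrite ?expR_ge0 ?(ltW q_gt0) //.
    by apply: (q_le (a, b)); rewrite mulr_gt0.
  by rewrite ler_expR lerN2 ler_pM2r ?invr_gt0.
have : path (fun a b => `|f a - f b| <= Num.sqrt r2) x p.
  have : path (fun a b => edge Q a b && (Num.min (U a) (U b) <= h)) x p.
    rewrite (path_relI (edge Q)) path_p /=.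
    apply: sub_path (path_Elev2 U x p) => a b le_e.
    exact: le_trans le_e elev_p.
  by apply: sub_path => a b /andP[Qab le_h]; apply: edge_le.
move=> path_f; have := path_lipschitz path_f; rewrite last_p => le_f.
have {le_f} : (f x - f y) ^+ 2 <= (size p)%:R ^+ 2 * r2.
  rewrite -[r2]sqr_sqrtr // -exprMn mulr_natl.
  rewrite -[X in X <= _]real_normK ?num_real //.
  by rewrite ler_pXn2r // nnegrE ?mulrn_wge0 ?sqrtr_ge0.
move=> le_f; rewrite /gibbs_weight [_ * _ * (_ * _)]mulrACA -expRD.
apply: (@le_trans _ _ (expR (- (U x / tau) - U y / tau) *
    ((size p)%:R ^+ 2 * r2))).
  apply: ler_pM => //; rewrite ?sqr_ge0 ?mulr_ge0 ?expR_ge0 //; try exact: ltW.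
  rewrite -[X in _ <= X]mul1r ler_wpM2r ?expR_ge0 //.
  by rewrite mulr_ile1 // ltW.
rewrite /r2.
have -> : expR (- (U x / tau) - U y / tau) *
    ((size p)%:R ^+ 2 * (expR (h / tau) / q * energy tau f)) =
    (size p)%:R ^+ 2 / q *
    ((expR (h / tau) * expR (- (U x / tau) - U y / tau)) * energy tau f).
  by ring.
apply: ler_wpM2l; first by rewrite divr_ge0 ?sqr_ge0 // ltW.
apply: ler_wpM2r; first exact: energy_ge0.
rewrite -expRD ler_expR.
have -> : h / tau + (- (U x / tau) - U y / tau) = (h - U x - U y) / tau by ring.
by rewrite ler_pM2r ?invr_gt0 //; apply: H2_le_cM2.
Qed.

End M2Gap.

Theorem lemma4p1 (R : realType) (X : finType) (cardX : (1 < #|X|)%N)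
  (U : X -> R) (U_ge0 : forall x, 0 <= U x) (U_min : exists x, U x = 0)
  (Q : X -> X -> R) (Q_gen : is_generator Q) (Q_erg : ergodic Q)
  (pi_ : X -> R) (pi_distr : is_distribution pi_)
  (pi_stat : stationary Q pi_) (pi_rev : reversible Q pi_)
  (T : R -> R) (T_cool : cooling_schedule T) :
  exists A : R, 0 < A /\
    forall t : R, 0 <= t ->
      lambda2 (- kernel_mx (M2 Q U (T t))) >= A * expR (- (cM2 Q U / T t)).
Proof.
have pi_gt0 := reversible_pi_gt0 Q_gen Q_erg pi_distr pi_rev.
have [x0 U_x0] := U_min.
have pi_le1 x : pi_ x <= 1.
  have [_ <-] := pi_distr; rewrite (bigD1 x) //= lerDl.
  by apply: sumr_ge0 => y _; apply: ltW.
have /choice[C C_bound] (z : X * X) : exists C : R, 0 <= C /\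
    forall (tau : R) (f : X -> R), 0 < tau ->
    gibbs_weight U pi_ tau z.1 * gibbs_weight U pi_ tau z.2 *
      (f z.1 - f z.2) ^+ 2 <=
    C * (expR (cM2 Q U / tau) * energy U Q pi_ tau f).
  have [C C_ge0 C_le] := pair_bound U Q_gen Q_erg pi_gt0 z.1 z.2 pi_le1.
  by exists C.
(* The summand 1 only serves to make the denominator positive. *)
pose Csum := 1 + \sum_z C z.
have Csum_gt0 : 0 < Csum.
  by rewrite ltr_pwDl // sumr_ge0 // => z _; have [] := C_bound z.
exists (pi_ x0 / Csum); split=> [|t t_ge0]; first exact: divr_gt0.
have [T_gt0 _ _] := T_cool; have tau_gt0 := T_gt0 t t_ge0.
set tau := T t in tau_gt0 *; pose mu := gibbs_weight U pi_ tau.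
have mu_gt0 x : 0 < mu x by rewrite mulr_gt0 ?expR_gt0.
have sumE (F : X -> R) : \sum_(i < #|X|) F (enum_val i) = \sum_x F x.
  by rewrite -big_enum_val.
apply: (@lambda2_ge _ _ _ (fun i => mu (enum_val i))) => // [i j|f f_mean].
  by rewrite !mxE !mulrN M2_reversible.
(* Matrices are indexed by the ranks of the states; [g] is [f] as a function on
   the states themselves. *)
pose g x := f (enum_rank x).
have fE i : f i = g (enum_val i) by rewrite /g enum_valK.
have g_mean : \sum_x mu x * g x = 0.
  by rewrite -sumE -[RHS]f_mean; apply: eq_bigr => i _; rewrite fE.
have -> : \sum_i mu (enum_val i) * f i ^+ 2 = \sum_x mu x * g x ^+ 2.
  by rewrite -sumE; apply: eq_bigr => i _; rewrite fE.
have -> : \sum_i mu (enum_val i) * f i *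
      (\sum_j (- kernel_mx (M2 Q U tau)) i j * f j) = energy U Q pi_ tau g / 2.
  rewrite /energy dirichlet_form; first last.
  - exact: M2_row_sum.
  - by move=> x y; apply: M2_reversible.
  rewrite mulrC mulKf ?pnatr_eq0 // -[RHS]sumE; apply: eq_bigr => i _.
  rewrite fE; congr (_ * _); rewrite -[RHS]sumE; apply: eq_bigr => j _.
  by rewrite !mxE fE.
have pairs : \sum_x \sum_y mu x * mu y * (g x - g y) ^+ 2 <=
    Csum * (expR (cM2 Q U / tau) * energy U Q pi_ tau g).
  rewrite pair_big /=.
  apply: le_trans (ler_sum _ (fun z _ => (C_bound z).2 tau g tau_gt0)) _.
  rewrite -big_distrl /= ler_wpM2r ?lerDr //.
  by rewrite mulr_ge0 ?expR_ge0 // energy_ge0.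
rewrite (variance_pairs g_mean) in pairs.
set V := \sum_x mu x * g x ^+ 2 in pairs *.
have V_ge0 : 0 <= V.
  by apply: sumr_ge0 => x _; rewrite mulr_ge0 ?sqr_ge0 // ltW.
have Z_ge : pi_ x0 <= \sum_x mu x.
  rewrite (bigD1 x0) //= {1}/mu /gibbs_weight U_x0 mul0r oppr0 expR0 mulr1.
  by rewrite lerDl sumr_ge0 // => x _; apply: ltW.
have le_V : 2 * pi_ x0 * V <=
    Csum * (expR (cM2 Q U / tau) * energy U Q pi_ tau g).
  by apply: le_trans pairs; rewrite ler_wpM2r // ler_pM2l.
have e_gt0 := expR_gt0 (cM2 Q U / tau); rewrite expRN.
set e := expR _ in le_V e_gt0 *.
have -> : pi_ x0 / Csum * e^-1 * V = 2 * pi_ x0 * V / (2 * (Csum * e)).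
  by field; rewrite !gt_eqF.
rewrite ler_pdivrMr; last by rewrite !mulr_gt0.
by apply: le_trans le_V _; rewrite le_eqVlt; apply/orP; left; apply/eqP; field.
Qed.
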